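(* There exists an absolute constant $E_0$ such that the following holds for all positive integers $E,D,N$ with $E\ge E_0$, $E\ge e^{9D}$ and $N\ge E^4$: a random GBS graph with parameters $V=1$, $E$, $D$, $N$ is flexible with probability at least $1-\frac{1}{\sqrt[4]{E}}$.
   Context: A graph $\Gamma$ consists of a vertex set $V(\Gamma)$, a set $E(\Gamma)$ of (oriented) edges, a reverse map $e\mapsto\overline{e}$ on $E(\Gamma)$ with $\overline{e}\neq e$ and $\overline{\overline{e}}=e$, and an initial vertex map $\iota:E(\Gamma)\to V(\Gamma)$; the terminal vertex is $\tau(e)=\iota(\overline{e})$. A topological edge is a pair $\{e,\overline e\}$. Loops and multiple edges are allowed. A GBS graph is a pair $(\Gamma,\psi)$ with $\Gamma$ a finite graph and $\psi:E(\Gamma)\to\mathbb{Z}\setminus\{0\}$; $\psi(e)$ is the label on $e$ near $\tau(e)$. When $\Gamma$ is connected, the GBS group represented by $(\Gamma,\psi)$ is defined as follows. Choose a maximal tree $T=\overline{T}\subseteq E(\Gamma)$. The generators are $a_v$ for $v\in V(\Gamma)$ and $t_e$ for $e\in E(\Gamma)\setminus T$. The relations are: $a_{\iota(e)}^{\psi(\overline e)}=a_{\tau(e)}^{\psi(e)}$ for $e\in T$; and $t_{\overline e}=t_e^{-1}$ and $a_{\iota(e)}^{\psi(\overline e)}t_e=t_e a_{\tau(e)}^{\psi(e)}$ for $e\in E(\Gamma)\setminus T$. The isomorphism type does not depend on $T$. Fully reduced: a connected $(\Gamma,\psi)$ is fully reduced if there are no distinct vertices $v,u$ such that, in its GBS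 group, $a_v$ is conjugate to a power of $a_u$. Set of primes: $\mathcal{P}(\Gamma,\psi)$ is the set of primes $r$ with $r\mid\psi(e)$ for some $e\in E(\Gamma)$. Minimal edge: $e\in E(\Gamma)$ is minimal if there is no $e'\in E(\Gamma)$ with $\tau(e')=\tau(e)$, $\psi(e')\mid\psi(e)$ and $\psi(e')\neq\pm\psi(e)$. Flexible: a connected $(\Gamma,\psi)$ is flexible if (1) it is fully reduced; (2) there is no $e\in E(\Gamma)$ such that both $e$ and $\overline e$ are minimal; (3) for every two distinct edges $e,e'\in E(\Gamma)$ with $\tau(e)=\tau(e')$, if $\psi(e)\mid\psi(e')$ then $\psi(e')/\psi(e)$ is a multiple of every prime in $\mathcal{P}(\Gamma,\psi)$. Random GBS graph with parameters $V,E,D,N$ (positive integers): fix a set $\{p_1,\dots,p_D\}$ of $D$ distinct primes (which one is irrelevant for flexibility). The vertex set is $[V]=\{1,\dots,V\}$. Let $v_1,\dots,v_{2E}$ be independent and uniform in $[V]$; the $E$ topological edges join $v_{2i-1}$ to $v_{2i}$, $i=1,\dots,E$ (a loop if these coincide; for $V=1$ all edges are loops). Independently of the graph, each of the $2E$ oriented edges $e_i$ receives the label $\psi(e_i)=(-1)^{\epsilon_i}\prod_{j=1}^D p_j^{\alpha_{i,j}}$, where all $\epsilon_i$ and $\alpha_{i,j}$ are independent, $\epsilon_i$ is uniform in $\{0,1\}$ and $\alpha_{i,j}$ is uniform in $\{0,1,\dots,N-1\}$. *)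

(* Defs.v *)
From HB Require Import structures.
From mathcomp Require Import all_boot all_order all_algebra.
From mathcomp Require Import all_classical all_reals all_analysis.

Set Implicit Arguments.
Unset Strict Implicit.
Unset Printing Implicit Defensive.

Import Order.TTheory GRing.Theory Num.Theory.

Local Open Scope ring_scope.

(* Words in the letters x^{+1} = (x, false) and x^{-1} = (x, true). *)
Definition word (X : Type) := seq (X * bool).

Definition word_inv (X : Type) (w : word X) : word X :=
  rev [seq (l.1, ~~ l.2) | l <- w].

Definition word_pow (X : Type) (x : X) (k : int) : word X :=
  nseq `|k|%N (x, k < 0).

(* Equality in the group presented by < X | u = v for rels u v >: the elements
   of that group are the words over X modulo this congruence. *)
Inductive pres_eq (X : Type) (rels : word X -> word X -> Prop) :
    word X -> word X -> Prop :=
  | pres_rel u v : rels u v -> pres_eq rels u v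
  | pres_cancel x b : pres_eq rels [:: (x, b); (x, ~~ b)] [::]
  | pres_refl u : pres_eq rels u u
  | pres_sym u v : pres_eq rels u v -> pres_eq rels v u
  | pres_trans u v w : pres_eq rels u v -> pres_eq rels v w -> pres_eq rels u w
  | pres_cat u u' v v' : pres_eq rels u u' -> pres_eq rels v v' ->
      pres_eq rels (u ++ v) (u' ++ v').

Record gbs_graph := GBSGraph {
  vertex : finType;
  edge : finType;
  erev : edge -> edge;
  erev_neq : forall e, erev e != e;
  erevK : involutive erev;
  init : edge -> vertex;
  label : edge -> int;
  label_neq0 : forall e, label e != 0
}.

Section GBSGraph.
Variable G : gbs_graph.

Definition term (e : edge G) : vertex G := init (erev e).

Definition adj (T : {set edge G}) : rel (vertex G) :=
  [rel u v | [exists e in T, (init e == u) && (term e == v)]].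

Definition gconnected : Prop :=
  (0 < #|vertex G|)%N /\ forall u v : vertex G, connect (adj [set: edge G]) u v.

(* f may follow e in a path without backtracking. *)
Definition follows : rel (edge G) :=
  [rel e f | (term e == init f) && (f != erev e)].

(* Acyclicity: T contains no nonempty closed path without backtracking
   (in particular no loop). *)
Definition maximal_tree (T : {set edge G}) : Prop :=
  [/\ forall e, e \in T -> erev e \in T,
      forall u v, connect (adj T) u v
    & forall s : seq (edge G), s != [::] -> all (mem T) s -> ~~ cycle follows s].

Section Group.
Variable T : {set edge G}.

Definition gbs_gen : Type := (vertex G + {e : edge G | e \notin T})%type.

Definition gen_a (v : vertex G) : gbs_gen := inl v.
Definition gen_t (e : edge G) (he : e \notin T) : gbs_gen :=
  inr (exist _ e he).

Inductive gbs_rel : word gbs_gen -> word gbs_gen -> Prop :=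
  | gbs_rel_tree e : e \in T ->
      gbs_rel (word_pow (gen_a (init e)) (label (erev e)))
              (word_pow (gen_a (term e)) (label e))
  | gbs_rel_inv e (he : e \notin T) (he' : erev e \notin T) :
      gbs_rel [:: (gen_t he', false)] [:: (gen_t he, true)]
  | gbs_rel_edge e (he : e \notin T) :
      gbs_rel
        (word_pow (gen_a (init e)) (label (erev e)) ++ [:: (gen_t he, false)])
        ([:: (gen_t he, false)] ++ word_pow (gen_a (term e)) (label e)).

Definition conj_to_power (v u : vertex G) : Prop :=
  exists (g : word gbs_gen) (k : int),
    pres_eq gbs_rel (word_inv g ++ word_pow (gen_a v) 1 ++ g)
                    (word_pow (gen_a u) k).

End Group.

(* Changing the maximal tree changes the group by an isomorphism that maps
   each a_v to a conjugate of a_v, so the choice of T is immaterial; a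
   connected graph has at least one. *)
Definition fully_reduced : Prop :=
  gconnected /\
  forall T : {set edge G}, maximal_tree T ->
    ~ exists v u : vertex G, v <> u /\ conj_to_power T v u.

Definition in_primes (r : nat) : Prop :=
  prime r /\ exists e : edge G, (r%:Z %| label e)%Z.

Definition minimal_edge (e : edge G) : Prop :=
  ~ exists e' : edge G,
      [/\ term e' = term e, (label e' %| label e)%Z,
          label e' <> label e & label e' <> - label e].

Definition flexible : Prop :=
  [/\ gconnected,
      fully_reduced,
      ~ exists e : edge G, minimal_edge e /\ minimal_edge (erev e)
    & forall e e' : edge G, e <> e' -> term e = term e' ->
        (label e %| label e')%Z ->
        forall r : nat, in_primes r -> (r%:Z %| label e' %/ label e)%Z].

End GBSGraph.

(* The i-th topological edge is {(i, false), (i, true)}. *)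
Definition oedge (E : nat) : finType := ('I_E * bool)%type.

Definition oedge_rev (E : nat) (e : oedge E) : oedge E := (e.1, ~~ e.2).

Lemma oedge_rev_neq (E : nat) (e : oedge E) : oedge_rev e != e.
Proof. by case: e => i []; rewrite /oedge_rev xpair_eqE andbF. Qed.

Lemma oedge_revK (E : nat) : involutive (@oedge_rev E).
Proof. by case=> i b; rewrite /oedge_rev /= negbK. Qed.

(* An outcome (v, eps, alpha): the initial vertices of the 2E oriented edges,
   the signs of their labels, and the exponents of the primes in them. *)
Definition outcome (V E D N : nat) : finType :=
  ({ffun oedge E -> 'I_V} * {ffun oedge E -> bool}
   * {ffun oedge E * 'I_D -> 'I_N})%type.

Section RandomGraph.
Variables (V E D N : nat) (p : 'I_D -> nat).

Definition random_label (w : outcome V E D N) (e : oedge E) : int :=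
  (-1) ^+ w.1.2 e * \prod_(j < D) (p j)%:Z ^+ w.2 (e, j).

Lemma random_label_neq0 (p_prime : forall j, prime (p j))
  (w : outcome V E D N) (e : oedge E) : random_label w e != 0.
Proof.
rewrite mulf_neq0 ?signr_eq0 //; apply/prodf_neq0 => j _.
by rewrite expf_neq0 // -lt0n prime_gt0.
Qed.

Definition random_graph (p_prime : forall j, prime (p j))
    (w : outcome V E D N) : gbs_graph :=
  GBSGraph (@oedge_rev_neq E) (@oedge_revK E) w.1.1
    (random_label_neq0 p_prime w).

End RandomGraph.

Definition unif (R : realType) (A : finType) (x : A) : R := #|A|%:R^-1.

(* All coordinates of the outcome are independent and uniform. *)
Definition outcome_mass (R : realType) (V E D N : nat)
    (w : outcome V E D N) : R :=
  (\prod_(e : oedge E) unif R (w.1.1 e)) *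
  (\prod_(e : oedge E) unif R (w.1.2 e)) *
  (\prod_(x : oedge E * 'I_D) unif R (w.2 x)).

Definition outcome_prob (R : realType) (V E D N : nat)
    (A : outcome V E D N -> Prop) : R :=
  \sum_(w : outcome V E D N | `[< A w >]) outcome_mass R w.

(* Main.v *)
Require Import Defs.
From HB Require Import structures.
From mathcomp Require Import all_boot all_order all_algebra.
From mathcomp Require Import all_classical all_reals all_analysis.
From mathcomp Require Import ring lra.

(* With one vertex, connectedness and full reducedness are automatic, so only
   the 2E exponent vectors in {0..N-1}^D matter.  If no two of them agree in
   any coordinate, condition (3) holds; such an agreement has probability at
   most (2E)^2 D / N.  If moreover each topological edge {e, e'} has one of its two
   exponent vectors x, y above the vector of some edge outside {e, e'}, then
   condition (2) holds.  For fixed x, y the other 2E - 2 vectors all avoid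
   box x and box y, whose union has density at least (vol x + vol y) / 2, with
   probability at most exp (- (E - 1) (vol x + vol y)); averaging over the
   independent x and y gives the square of the mean of exp (- (E - 1) vol x).
   By exp (- t) <= t^(-7/8) this mean is at most (E - 1)^(-7/8) times the D-th
   power of the mean of (k / N)^(-7/8) over 1 <= k <= N, which is at most 8.
   Since 8^D <= E^(4/17), the union bound over the E edges gives
   O(E^(1 - 7/4 + 8/17)) = O(E^(-19/68)), which is o(E^(-1/4)). *)

Set Implicit Arguments.
Unset Strict Implicit.
Unset Printing Implicit Defensive.

Import Order.TTheory GRing.Theory Num.Theory.

Local Open Scope ring_scope.

(** * Two inequalities for real powers *)

(** After inversion: t^s is at most 1 if t <= 1 and at most t otherwise, and both are at most
    e^t. *)
Lemma expRN_le_powRN (R : realType) (t s : R) :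
  0 < t -> 0 <= s <= 1 -> expR (- t) <= t `^ (- s).
Proof.
move=> t0 /andP[s0 s1].
rewrite expRN powRN lef_pV2 ?posrE ?expR_gt0 ?powR_gt0 //.
have [t1|t1] := leP t 1.
  apply: (@le_trans _ _ 1); last by rewrite -[leLHS]expR0 ler_expR ltW.
  have oneX : 1 `^ s = 1 :> R by rewrite powR1.
  by rewrite -[leRHS]oneX ge0_ler_powR ?nnegrE ?ler01 ?(ltW t0).
apply: (@le_trans _ _ t); last by apply: le_trans (expR_ge1Dx t); rewrite lerDr.
by rewrite -[leRHS]powRr1 ?(ltW t0) // ler_powR // ltW.
Qed.

(** Discrete form of the integral of x^(c-1), with c = 1/(d+1). As c is the inverse of an integer,
    the step is algebraic: a = (n+1)^c and b = n^c satisfy a^(d+1) - b^(d+1) = 1, and factoring out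
    a - b leaves d+1 terms, each at most a^d. *)
Lemma sum_powR_le (R : realType) (d n : nat) :
  \sum_(i < n) i.+1%:R `^ (- (1 - d.+1%:R^-1)) <=
  d.+1%:R * n%:R `^ d.+1%:R^-1 :> R.
Proof.
elim: n => [|n IHn]; first by rewrite big_ord0 mulr_ge0 ?powR_ge0.
rewrite big_ord_recr /=; apply: le_trans (lerD IHn (lexx _)) _.
set c := d.+1%:R^-1; set a := n.+1%:R `^ c; set b := n%:R `^ c.
have c0 : 0 < c by rewrite invr_gt0.
have a0 : 0 < a by rewrite powR_gt0.
have b0 : 0 <= b by rewrite powR_ge0.
have ba : b <= a by rewrite ge0_ler_powR ?nnegrE ?(ltW c0) ?ler_nat.
have powK (x : R) : 0 <= x -> (x `^ c) ^+ d.+1 = x.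
  by move=> x0; rewrite -powR_mulrn ?powR_ge0 // -powRrM mulVf // powRr1.
have diff : 1 <= (a - b) * (d.+1%:R * a ^+ d).
  have powB : a ^+ d.+1 - b ^+ d.+1 = 1 by rewrite !powK // -natr1; ring.
  apply: (@le_trans _ _ (a ^+ d.+1 - b ^+ d.+1)); first by rewrite powB.
  rewrite subrXX ler_wpM2l ?subr_ge0 //.
  apply: (@le_trans _ _ (\sum_(i < d.+1) a ^+ d)).
    apply: ler_sum => i _ /=.
    rewrite -[X in a ^+ X](@subnK i) 1?exprD; last by rewrite -ltnS.
    by rewrite ler_wpM2l ?exprn_ge0 ?(ltW a0) // lerXn2r ?nnegrE ?(ltW a0).
  by rewrite sumr_const card_ord mulrC mulr_natr.
have -> : n.+1%:R `^ (- (1 - c)) = (a ^+ d)^-1.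
  rewrite -powR_mulrn ?ltW // -powRrM -powRN; congr (_ `^ - _).
  have : c * d.+1%:R = 1 by rewrite mulVf.
  by rewrite -natr1 mulrDr mulr1 => h; apply/eqP; rewrite subr_eq h.
rewrite -lerBrDl -mulrBr -div1r ler_pdivrMr ?exprn_gt0 //.
by rewrite [leRHS](_ : _ = (a - b) * (d.+1%:R * a ^+ d)) //; ring.
Qed.

(** * Counting functions on a finite set *)

Lemma card_bigcup_le (I T : finType) (P : pred I) (A : I -> {set T}) :
  (#|\bigcup_(i | P i) A i| <= \sum_(i | P i) #|A i|)%N.
Proof.
elim/big_rec2: _ => [|i n B _ IH]; first by rewrite cards0.
by apply: leq_trans (leq_card_setU _ _) _; rewrite leq_add2l.
Qed.

(** Counting version of conditioning on [f a] and [f b]: once these are fixed, the other #|I| - 2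
    values range independently over [P (f a) (f b)]. *)
Lemma card_ffun_two_points_le (I X : finType) (a b : I) (r : rel X)
    (P : X -> X -> pred X) : a != b ->
  (#|[set f : {ffun I -> X} | r (f a) (f b) &&
       [forall c, (c != a) ==> (c != b) ==> P (f a) (f b) (f c)]]|
   <= \sum_(u : X * X | r u.1 u.2) #|P u.1 u.2| ^ (#|I| - 2))%N.
Proof.
move=> ab.
(* [F u] pins the values at [a] and [b] to [u], so the functions counted for [u] form a product
   family. *)
pose F (u : X * X) c : pred X :=
  if c == a then pred1 u.1 : pred X else if c == b then pred1 u.2 : pred X else P u.1 u.2.
apply: (@leq_trans #|\bigcup_(u | r u.1 u.2) [set f | f \in family (F u)]|).
  apply/subset_leq_card/fintype.subsetP => f; rewrite inE => /andP[rf /forallP Pf].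
  apply/bigcupP; exists (f a, f b) => //; rewrite inE; apply/familyP => c.
  rewrite /F; case: eqP => [->|/eqP ca]; first by rewrite inE.
  case: eqP => [->|/eqP cb]; first by rewrite inE.
  by have := Pf c; rewrite ca cb.
apply: leq_trans (card_bigcup_le _ _) _; apply: leq_sum => u _.
rewrite cardsE card_family foldrE big_map big_enum /= (bigD1 a) //= (bigD1 b) 1?eq_sym //=.
rewrite /F !eqxx eq_sym (negbTE ab) !card1 !mul1n.
under eq_bigr => c /andP[ca cb] do rewrite (negbTE ca) (negbTE cb).
rewrite prod_nat_const leq_eqVlt; apply/orP; left; apply/eqP; congr (_ ^ _)%N.
have := cardC (pred2 a b); rewrite card2 ab /= => <-; rewrite addKn.
by apply: eq_card => c; rewrite !inE negb_or.
Qed.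

(** Two coordinates agree with probability at most 1/#|X|, stated without division. *)
Lemma card_ffun_collision_le (I X : finType) (a b : I) : a != b ->
  (#|[set f : {ffun I -> X} | f a == f b]| * #|X| <= #|X| ^ #|I|)%N.
Proof.
move=> ab; have I2 : (1 < #|I|)%N.
  by have := max_card (pred2 a b); rewrite card2 ab.
have := @card_ffun_two_points_le I X a b eq_op (fun _ _ => predT) ab.
set S := [set _ | _]; set S' := [set _ | _].
have -> : S = S'.
  apply/setP => f; rewrite !inE; set P := [forall c, _].
  by rewrite (_ : P = true) ?andbT //; apply/forallP => c; rewrite !implybT.
move=> h; rewrite -[in leqRHS](subnK I2) expnD mulnA leq_mul // (leq_trans h) //.
rewrite -(pair_big_dep predT eq_op (fun _ _ => #|X| ^ (#|I| - 2))%N) /=.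
under eq_bigr => x _ do under eq_bigl => y do rewrite eq_sym.
under eq_bigr => x _ do rewrite big_pred1_eq.
by rewrite sum_nat_const mulnC.
Qed.

(** * Boxes of exponent vectors and their volumes *)

(** The exponent vectors of the labels that divide a label with exponent vector [x]. *)
Definition box (D N : nat) (x : {ffun 'I_D -> 'I_N}) : {set {ffun 'I_D -> 'I_N}} :=
  [set z : {ffun 'I_D -> 'I_N} | [forall j, z j <= x j]%N].

(** The density of [box x]; exponents start at 0, hence the successor. *)
Definition volume (R : realType) (D N : nat) (x : {ffun 'I_D -> 'I_N}) : R :=
  \prod_(j < D) ((x j).+1%:R / N%:R).

Lemma card_box (R : realType) (D N : nat) (x : {ffun 'I_D -> 'I_N}) :
  (0 < N)%N -> #|box x|%:R = (N ^ D)%:R * volume R x.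
Proof.
move=> N0.
have -> : #|box x| = #|family (fun j => [pred k : 'I_N | k <= x j]%N)|.
  apply: eq_card => z; rewrite [LHS]inE.
  apply/idP/idP => [/forallP h|/familyP h].
    by apply/familyP => j; rewrite inE.
  by apply/forallP => j; have := h j; rewrite inE.
have -> : #|family (fun j => [pred k : 'I_N | k <= x j]%N)| = (\prod_(j < D) (x j).+1)%N.
  rewrite card_family foldrE big_map big_enum /=; apply: eq_bigr => j _.
  rewrite -sum1_card.
  rewrite -(big_ord_widen_leq _ (fun=> true) (fun=> 1%N) (ltn_ord (x j))) /=.
  by rewrite sum1_card card_ord.
rewrite natr_prod /volume prodf_div prodr_const card_ord natrX mulrC divfK //.
by rewrite expf_neq0 // pnatr_eq0 -lt0n.
Qed.

(** The union is at least as large as each box, hence as their average; then 1 - t <= e^(-t). *)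
Lemma card_setC_boxU_le (R : realType) (D N : nat) (x y : {ffun 'I_D -> 'I_N}) :
  (0 < N)%N ->
  #|~: (box x :|: box y)|%:R <=
    (N ^ D)%:R * expR (- ((volume R x + volume R y) / 2)).
Proof.
move=> N0.
have ND0 : 0 <= (N ^ D)%:R :> R by [].
have cx := card_box R x N0; have cy := card_box R y N0.
have xU : #|box x|%:R <= #|box x :|: box y|%:R :> R.
  by rewrite ler_nat subset_leq_card // finset.subsetUl.
have yU : #|box y|%:R <= #|box x :|: box y|%:R :> R.
  by rewrite ler_nat subset_leq_card // finset.subsetUr.
have tot : #|box x :|: box y|%:R + #|~: (box x :|: box y)|%:R = (N ^ D)%:R :> R.
  by rewrite -natrD cardsC card_ffun !card_ord.
have := ler_wpM2l ND0 (expR_ge1Dx (- ((volume R x + volume R y) / 2))).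
apply: le_trans; rewrite mulrDr mulr1 mulrN mulrA mulrDr -cx -cy; lra.
Qed.

(** Replacing the exponential by a power makes the summand a product over coordinates, so the sum
    over vectors becomes the D-th power of a sum over one exponent. *)
Lemma sum_expRN_volume_le (R : realType) (d D N : nat) (m : R) :
  0 < m -> (0 < N)%N ->
  \sum_(x : {ffun 'I_D -> 'I_N})
     expR (- (m * volume R x)) <=
  m `^ (- (1 - d.+1%:R^-1)) * (d.+1 * N)%:R ^+ D.
Proof.
move=> m0 N0; rewrite /volume; set s := 1 - _.
have c01 : 0 < (d.+1%:R^-1 : R) <= 1.
  by rewrite invr_gt0 ltr0n /= invf_le1 ?ltr0n // ler1n.
have s01 : 0 <= s <= 1.
  by move: c01; rewrite /s => /andP[c0 c1]; rewrite subr_ge0 c1 gerBl ltW.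
have NR0 : 0 < N%:R :> R by rewrite ltr0n.
(* The bound (d+1) N^(1-s) of [sum_powR_le] meets the factor N^s coming from the division by N. *)
have sum1 : \sum_(k < N) (k.+1%:R / N%:R) `^ (- s) <= (d.+1 * N)%:R :> R.
  under eq_bigr do rewrite powRM ?invr_ge0 // -[_^-1 `^ _]mulr1.
  rewrite -mulr_suml mulr1.
  apply: le_trans (ler_wpM2r (powR_ge0 _ _) (sum_powR_le _ _ _)) _.
  rewrite -[N%:R^-1]powR_inv1 ?(ltW NR0) // -powRrM -mulrA -powRD; last first.
    by rewrite (gt_eqF NR0) implybT.
  rewrite [X in _ `^ X](_ : _ = 1) ?powRr1 ?(ltW NR0) // ?natrM //.
  by rewrite /s; ring.
apply: (@le_trans _ _ (\sum_(x : {ffun 'I_D -> 'I_N})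
    m `^ (- s) * \prod_(j < D) ((x j).+1%:R / N%:R) `^ (- s))).
  apply: ler_sum => x _.
  have P0 : 0 < \prod_(j < D) ((x j).+1%:R / N%:R) :> R.
    by apply: prodr_gt0 => j _; rewrite divr_gt0.
  apply: le_trans (expRN_le_powRN _ s01) _; first by rewrite mulr_gt0.
  rewrite powRM ?(ltW m0) ?(ltW P0) // ler_wpM2l ?powR_ge0 //.
  rewrite le_eqVlt; apply/orP; left; apply/eqP.
  elim: (index_enum _) => [|j r IHr]; first by rewrite !big_nil powR1.
  by rewrite !big_cons powRM ?divr_ge0 ?prodr_ge0 ?IHr // => i _; rewrite divr_ge0.
rewrite -mulr_sumr ler_wpM2l ?powR_ge0 //.
rewrite -(bigA_distr_bigA (fun _ (k : 'I_N) => (k.+1%:R / N%:R : R) `^ (- s))).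
rewrite prodr_const card_ord lerXn2r ?nnegrE ?ler0n //.
by apply: sumr_ge0 => k _; apply: powR_ge0.
Qed.

(** * Numerical estimate of the failure probability *)

(* (1 + 3/136)^32 >= 2, by five rounded squarings. *)
Lemma two_le_expR (R : realType) : 2 <= expR (12 / 17) :> R.
Proof.
have sqr (a b y : R) : 0 <= a -> a <= expR y -> b <= a * a -> b <= expR (y * 2%:R).
  move=> a0 ay ba; rewrite expRM_natr (le_trans ba) // -expr2.
  by rewrite lerXn2r ?nnegrE ?expR_ge0.
have e1 : 139 / 136 <= expR (3 / 136) :> R.
  by apply: le_trans (expR_ge1Dx _); lra.
have e2 : 164 / 157 <= expR (3 / 136 * 2%:R) :> R by apply: sqr e1 _; lra.
have e4 : 12 / 11 <= expR (3 / 136 * 2%:R * 2%:R) :> R by apply: sqr e2 _; lra.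
have e8 := sqr _ _ _ _ e4 (lexx _).
have e16 : 99 / 70 <= expR (3 / 136 * 2%:R * 2%:R * 2%:R * 2%:R) :> R.
  by apply: sqr (e8 _) _; lra.
have -> : 12 / 17 = 3 / 136 * 2%:R * 2%:R * 2%:R * 2%:R * 2%:R :> R by field.
by apply: sqr e16 _; lra.
Qed.

(** The summands bound the probabilities of a collision, with N replaced by E^4, and of an
    undominated edge. Each is at most 4 E^(-19/68). *)
Lemma failure_bound_small (R : realType) :
  exists E0 : nat, forall E D : nat, (E0 <= E)%N -> (0 < E)%N ->
    expR (9 * D%:R) <= E%:R :> R ->
    (1 < E)%N /\
    (2 * E)%:R ^+ 2 * D%:R / E%:R ^+ 4 +
      E%:R * ((E.-1)%:R `^ (- (1 - 8^-1)) * 8 ^+ D) ^+ 2 <=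
    (E%:R `^ (4^-1))^-1 :> R.
Proof.
(* This threshold gives E^(1/34) >= 8 = 4 + 4, which absorbs both constants because 19/68 = 1/4 +
   1/34. *)
exists (8 ^ 34)%N => E D E0E Epos hE.
set x : R := E%:R.
have x0 : 0 < x by rewrite ltr0n.
have xn0 : x != 0 by rewrite gt_eqF.
have E1 : (1 < E)%N.
  by apply: leq_ltn_trans (leq_trans (ltn_expl 34 (isT : (1 < 8)%N)) E0E).
have x2 : 2 <= x by rewrite ler_nat.
have x34 : 8 <= x `^ 34^-1.
  have <- : (8 ^+ 34) `^ 34^-1 = 8 :> R.
    by rewrite -powR_mulrn // -powRrM mulfV // powRr1.
  by rewrite ge0_ler_powR ?nnegrE ?exprn_ge0 ?(ltW x0) // -natrX ler_nat.
clear E0E. (* lra would otherwise evaluate [8 ^ 34] *)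
split=> //.
(* From 2 <= e^(12/17) follows 8^D <= e^(36D/17) = (e^(9D))^(4/17). *)
have D8 : 8 ^+ D <= x `^ (4 / 17).
  have -> : 8 ^+ D = 2 ^+ (3 * D) :> R by rewrite exprM; congr (_ ^+ _); ring.
  apply: (@le_trans _ _ (expR (12 / 17) ^+ (3 * D))).
    by rewrite lerXn2r ?nnegrE ?expR_ge0 // two_le_expR.
  have -> : expR (12 / 17) ^+ (3 * D) = expR (9 * D%:R) `^ (4 / 17) :> R.
    by rewrite -expRM_natr -expRM natrM; congr expR; field.
  by rewrite ge0_ler_powR ?nnegrE ?expR_ge0 ?(ltW x0) //; lra.
have Dx : D%:R <= x.
  apply: le_trans hE; apply: le_trans (expR_ge1Dx _).
  by have : 0 <= D%:R :> R by []; lra.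
(* Uses E - 1 >= E/2 and 2^(7/8) <= 2. *)
have Ex : (E.-1)%:R `^ (- (1 - 8^-1)) <= 2 * x `^ (- (1 - 8^-1)) :> R.
  have px : x / 2 <= (E.-1)%:R.
    have -> : (E.-1)%:R = x - 1 :> R by rewrite /x -(prednK Epos) -natr1 /=; ring.
    lra.
  rewrite !powRN; apply: (@le_trans _ _ ((x / 2) `^ (1 - 8^-1))^-1).
    rewrite lef_pV2 ?posrE ?powR_gt0 ?divr_gt0 //; last by apply: lt_le_trans px; lra.
    rewrite ge0_ler_powR ?nnegrE //; last by lra.
    lra.
  rewrite powRM ?(ltW x0) // invfM mulrC ler_wpM2r ?invr_ge0 ?powR_ge0 //.
  rewrite -powRN -[2^-1]powR_inv1 // -powRrM.
  by rewrite -[leRHS]powRr1 // ler_powR; lra.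
have T2 : x * ((E.-1)%:R `^ (- (1 - 8^-1)) * 8 ^+ D) ^+ 2 <= 4 * x `^ (- (19 / 68)).
  have -> : 4 * x `^ (- (19 / 68)) = x * (2 * x `^ (- (1 - 8^-1)) * x `^ (4 / 17)) ^+ 2.
    have <- : x `^ (- (1 - 8^-1) + 4 / 17) ^+ 2 * x = x `^ (- (19 / 68)).
      rewrite -powR_mulrn ?powR_ge0 // -powRrM -[X in _ * X]powRr1 ?(ltW x0) //.
      by rewrite -powRD ?xn0 ?implybT //; congr (_ `^ _); field.
    by rewrite powRD ?xn0 ?implybT //; ring.
  by rewrite ler_pM2l // lerXn2r ?nnegrE ?mulr_ge0 ?powR_ge0 ?exprn_ge0 // ler_pM ?powR_ge0 ?exprn_ge0.
(* With D <= E the collision term is at most 4/E. *)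
have T1 : (2 * E)%:R ^+ 2 * D%:R / x ^+ 4 <= 4 * x `^ (- (19 / 68)).
  apply: (@le_trans _ _ (4 * x `^ (- 1))).
    rewrite powR_inv1 ?(ltW x0) // natrM -/x.
    rewrite [leRHS](_ : _ = (2 * x) ^+ 2 * x / x ^+ 4); last by field.
    by rewrite ler_wpM2r ?invr_ge0 ?exprn_ge0 ?(ltW x0) // ler_wpM2l // exprn_ge0 // mulr_ge0 // ltW.
  by rewrite ler_wpM2l // ler_powR; lra.
apply: le_trans (lerD T1 T2) _.
have -> : (x `^ 4^-1)^-1 = x `^ (34^-1) * x `^ (- (19 / 68)).
  by rewrite -powRN -powRD ?xn0 ?implybT //; congr (_ `^ _); field.
rewrite -mulrDl ler_wpM2r ?powR_ge0 //.
by lra.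
Qed.

(** * Divisibility of labels through exponents *)

Section Labels.
Variables (V E D N : nat) (p : 'I_D -> nat).
Hypotheses (p_prime : forall j, prime (p j)) (p_inj : injective p).
Implicit Types (w : outcome V E D N) (e : oedge E).

Lemma absz_random_label w e :
  `|random_label p w e|%N = (\prod_(j < D) p j ^ w.2 (e, j))%N.
Proof.
rewrite /random_label abszM abszX abszN1 exp1n mul1n.
by elim/big_rec2: _ => // j m z _ <-; rewrite abszM abszX absz_nat.
Qed.

Lemma logn_random_label w e j :
  logn (p j) `|random_label p w e|%N = w.2 (e, j).
Proof.
rewrite absz_random_label (bigD1 j) //= mulnC logn_Gauss ?pfactorK //.
apply: (big_ind (fun n => coprime (p j) n)) => [|m n cm cn|i ij]; first by rewrite coprimen1.
  by rewrite coprimeMr cm.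
rewrite coprimeXr // prime_coprime // dvdn_prime2 //.
by apply: contra_neqN ij => /eqP/p_inj.
Qed.

Lemma dvdz_random_label w e e' :
  (random_label p w e %| random_label p w e')%Z =
  [forall j, w.2 (e, j) <= w.2 (e', j)]%N.
Proof.
apply/idP/forallP => [|h].
  rewrite dvdzE => /dvdn_leq_log h j; rewrite -!logn_random_label.
  by apply: h; rewrite absz_gt0 random_label_neq0.
rewrite dvdzE !absz_random_label.
by elim/big_ind2: _ => // [*|j _]; [apply: dvdn_mul | rewrite dvdn_exp2l].
Qed.

Lemma in_primes_random_graph w r :
  in_primes (random_graph p_prime w) r -> exists j, r = p j.
Proof.
case=> pr [e]; rewrite /= dvdzE absz_nat absz_random_label.
rewrite Euclid_dvd_prod // big_has_cond => /hasP[j _ /=].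
by rewrite Euclid_dvdX // dvdn_prime2 // => /andP[/eqP -> _]; exists j.
Qed.

End Labels.

(** * A sufficient condition for flexibility with one vertex *)

Section OneVertex.
Variables (E D N : nat) (p : 'I_D -> nat).
Hypotheses (p_prime : forall j, prime (p j)) (p_inj : injective p).

Lemma connected_random_graph (w : outcome 1 E D N) :
  gconnected (random_graph p_prime w).
Proof.
split; first by rewrite card_ord.
by move=> u v; rewrite /= (ord1 u) (ord1 v) connect0.
Qed.

(** Since no exponents agree, divisibility between labels of distinct edges is strict at every
    prime. So the quotient contains every [p j], and a label dividing another edge's label differs
    from it by more than a sign, which refutes minimality. *)
Lemma flexible_random_graph (w : outcome 1 E D N) : (0 < D)%N ->
  (forall e e' j, e != e' -> w.2 (e, j) != w.2 (e', j)) ->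
  (forall i, exists2 e, e.1 != i &
     exists b, [forall j, w.2 (e, j) <= w.2 ((i, b), j)]%N) ->
  flexible (random_graph p_prime w).
Proof.
move=> D0 distinct dominated; split.
- exact: connected_random_graph.
- split; first exact: connected_random_graph.
  by move=> T _ [v [u [vu _]]]; apply: vu; rewrite /= (ord1 v) (ord1 u).
- case=> -[i c] [min1 min2].
  have [e ei [b le_eb]] := dominated i.
  (* [erev] flips the Boolean, so the two assumptions cover both orientations, in particular the
     dominated one. *)
  have min b' : minimal_edge (G := random_graph p_prime w) (i, b').
    by case: (eqVneq b' c) => [-> //|]; rewrite -addNb => /addbP; case: b' c min1 min2 => [] [].
  apply: (min b); exists e.
  have neq : w.2 (e, Ordinal D0) != w.2 ((i, b), Ordinal D0).
    by apply: distinct; apply: contra_neq ei => ->.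
  split => //=; first by rewrite [LHS]ord1 [RHS]ord1.
  + by rewrite (dvdz_random_label p_prime p_inj).
  + move/(congr1 (fun z => logn (p (Ordinal D0)) `|z|%N)).
    by rewrite !logn_random_label // => h; rewrite (val_inj h) eqxx in neq.
  + move/(congr1 (fun z => logn (p (Ordinal D0)) `|z|%N)).
    by rewrite abszN !logn_random_label // => h; rewrite (val_inj h) eqxx in neq.
- move=> e e' ee' _ /= dv r hr; have [j -> /=] := in_primes_random_graph hr.
  (* Multiplied by the label of [e], the goal is that [p j] times this label divides the label of
     [e']; the strict inequality at [j] pays for the extra factor. *)
  rewrite -(dvdz_mul2r (p := random_label p w e)) ?random_label_neq0 // divzK //.
  move: dv; rewrite (dvdz_random_label p_prime p_inj) => /forallP le.
  have lt : (w.2 (e, j) < w.2 (e', j))%N.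
    by rewrite ltn_neqAle le andbT; apply: distinct; apply/eqP.
  rewrite dvdzE abszM absz_nat !absz_random_label.
  rewrite (bigD1 j) // [X in (_ %| X)%N](bigD1 j) //= mulnA -expnS.
  apply: dvdn_mul; first by rewrite dvdn_exp2l.
  by elim/big_ind2: _ => // [*|k _]; [apply: dvdn_mul | rewrite dvdn_exp2l].
Qed.

End OneVertex.

(** * From probability to counting *)

Lemma outcome_massE (R : realType) (V E D N : nat) (w : outcome V E D N) :
  outcome_mass R w = #|outcome V E D N|%:R^-1.
Proof.
rewrite /outcome_mass /unif !prodr_const !exprVn -!natrX -!card_ffun.
by rewrite -!invfM -!natrM -!card_prod.
Qed.

(** The bad event [B] constrains the exponents only, so the number [K] of choices of vertices and
    signs cancels. *)
Lemma outcome_prob_ge (R : realType) (V E D N : nat)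
    (A : outcome V E D N -> Prop) (B : {set {ffun oedge E * 'I_D -> 'I_N}}) :
  (0 < V)%N -> (0 < N)%N -> (forall w, w.2 \notin B -> A w) ->
  1 - #|B|%:R / #|{ffun oedge E * 'I_D -> 'I_N}|%:R <= outcome_prob R A.
Proof.
move=> V0 N0 BA; rewrite /outcome_prob.
under eq_bigr do rewrite outcome_massE.
rewrite sumr_const -[leRHS]mulr_natl.
set K := #|{: {ffun oedge E -> 'I_V} * {ffun oedge E -> bool}}|.
set M := #|{ffun oedge E * 'I_D -> 'I_N}|.
have KM : #|outcome V E D N| = (K * M)%N by rewrite card_prod.
have K0 : (0 < K)%N by rewrite /K card_prod !card_ffun card_ord card_bool muln_gt0 !expn_gt0 V0.
have M0 : (0 < M)%N by rewrite /M card_ffun card_ord expn_gt0 N0.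
have : (K * M <= #|[pred w : outcome V E D N | `[< A w >]]| + K * #|B|)%N.
  rewrite -KM -(cardC [pred w : outcome V E D N | `[< A w >]]) leq_add2l.
  have -> : (K * #|B|)%N = #|finset.setX [set: {ffun oedge E -> 'I_V} * {ffun oedge E -> bool}] B|.
    by rewrite cardsX cardsT.
  apply/subset_leq_card/fintype.subsetP => w; rewrite !inE /=.
  by apply: contraR => /BA h; apply/asboolP.
rewrite -(ler_nat R) natrD !natrM => h.
rewrite KM ler_pdivlMr ?natrM ?mulr_gt0 ?ltr0n // mulrBl mul1r.
rewrite [X in _ - X](_ : _ = K%:R * #|B|%:R) 1?lerBlDr //.
by field; rewrite pnatr_eq0 -lt0n.
Qed.

(** * The two kinds of bad exponents and their densities *)

Section BadSets.
Variables E D N : nat.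
Local Notation exponents := {ffun oedge E * 'I_D -> 'I_N}.

Definition exponent_vector (f : exponents) (e : oedge E) : {ffun 'I_D -> 'I_N} :=
  [ffun j => f (e, j)].

Definition collisions : {set exponents} :=
  \bigcup_(x : oedge E * oedge E * 'I_D | x.1.1 != x.1.2)
     [set f : exponents | f (x.1.1, x.2) == f (x.1.2, x.2)].

(** Failure at [i] of the domination hypothesis of [flexible_random_graph]. *)
Definition undominated (i : 'I_E) : {set exponents} :=
  [set f | [forall e, (e.1 != i) ==>
     (exponent_vector f e \notin
       box (exponent_vector f (i, false)) :|: box (exponent_vector f (i, true)))]].

Lemma card_exponents : #|{: exponents}| = (N ^ (2 * E * D))%N.
Proof. by rewrite card_ffun !card_prod !card_ord card_bool [(E * 2)%N]mulnC. Qed.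

(** Union bound over at most (2E)^2 D triples of two edges and a prime, each of probability at most
    1/N. *)
Lemma card_collisions_le (R : realType) : (0 < N)%N ->
  #|collisions|%:R / #|{: exponents}|%:R <= (2 * E)%:R ^+ 2 * D%:R / N%:R :> R.
Proof.
move=> N0; have NR0 : 0 < N%:R :> R by rewrite ltr0n.
have T0 : 0 < #|{: exponents}|%:R :> R by rewrite card_exponents ltr0n expn_gt0 N0.
rewrite ler_pdivrMr // mulrAC ler_pdivlMr // -natrX -!natrM ler_nat.
apply: (@leq_trans (\sum_(x : oedge E * oedge E * 'I_D) #|{: exponents}|)).
  apply: leq_trans (leq_mul (card_bigcup_le _ _) (leqnn _)) _.
  rewrite big_distrl /= big_mkcond /=; apply: leq_sum => -[[e e'] j] _ /=.
  case: ifP => // ee'.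
  have := @card_ffun_collision_le _ 'I_N (e, j) (e', j).
  by rewrite xpair_eqE eqxx andbT ee' -card_ffun card_ord; apply.
rewrite sum_nat_const !card_prod !card_ord card_bool.
by rewrite leq_mul // leq_mul // [(E * 2)%N]mulnC -mulnn.
Qed.

(** Condition on the two vectors at [i]; the remaining 2(E-1) vectors must independently avoid both
    boxes. *)
Lemma card_undominated_le (R : realType) (i : 'I_E) : (1 < E)%N -> (0 < N)%N ->
  #|undominated i|%:R / #|{: exponents}|%:R <=
    ((E.-1)%:R `^ (- (1 - 8^-1)) * 8 ^+ D) ^+ 2 :> R.
Proof.
move=> E1 N0; have E0 := ltnW E1.
set q := _ `^ _ * _.
have T0 : 0 < #|{: exponents}|%:R :> R by rewrite card_exponents ltr0n expn_gt0 N0.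
pose X := {ffun 'I_D -> 'I_N}.
(* Exponents are regrouped into one vector per edge, so that the two-point count applies. *)
pose curry (f : exponents) : {ffun oedge E -> X} := [ffun e => exponent_vector f e].
have curry_inj : injective curry.
  move=> f g fg; apply/ffunP => -[e j].
  have /ffunP/(_ e) := fg; rewrite !ffunE => /ffunP/(_ j).
  by rewrite !ffunE.
have ab : (i, false) != (i, true) by rewrite xpair_eqE andbF.
have := @card_ffun_two_points_le (oedge E) X _ _ (fun _ _ => true)
  (fun x y => mem (~: (box x :|: box y))) ab.
set S := [set f | _] => hS.
have cS : (#|undominated i| <= #|S|)%N.
  rewrite -(card_imset _ curry_inj); apply/subset_leq_card/fintype.subsetP => g /imsetP[f].
  rewrite inE => /forallP hf ->; rewrite inE /=; apply/forallP => e.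
  apply/implyP => e0; apply/implyP => e1; rewrite !ffunE inE.
  have := hf e; suff -> : e.1 != i by [].
  by case: e e0 e1 => i' [] /=; rewrite !xpair_eqE ?andbT ?andbF //=.
rewrite ler_pdivrMr //.
apply: le_trans (_ : (\sum_(u : X * X) #|~: (box u.1 :|: box u.2)| ^ (#|oedge E| - 2))%:R <= _).
  by rewrite ler_nat; apply: leq_trans cS _; apply: leq_trans hS _; apply: leq_sum.
have cE : (#|oedge E| - 2 = 2 * E.-1)%N.
  by rewrite card_prod card_ord card_bool -{1}(prednK E0) mulnC mulnS addKn.
rewrite cE natr_sum.
(* The power 2(E-1) cancels the 1/2 in [card_setC_boxU_le], leaving the factor E - 1. *)
set m : R := (E.-1)%:R.
apply: le_trans (_ : \sum_(u : X * X) (N ^ D)%:R ^+ (2 * E.-1) *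
    (expR (- (m * volume R u.1)) * expR (- (m * volume R u.2))) <= _).
  apply: ler_sum => -[x y] _ /=; rewrite natrX.
  apply: le_trans (lerXn2r (2 * E.-1) _ _ (card_setC_boxU_le R x y N0)) _;
    rewrite ?nnegrE ?mulr_ge0 ?expR_ge0 ?ler0n //.
  rewrite exprMn ler_wpM2l ?exprn_ge0 ?ler0n // -expRM_natl -expRD natrM -/m.
  by rewrite le_eqVlt; apply/orP; left; apply/eqP; congr expR; field.
(* The summand separates in the two vectors, so the double sum is a square. *)
rewrite -mulr_sumr -(pair_bigA _ (fun x y : X => expR (- (m * volume R x)) * expR (- (m * volume R y)))) /=.
under eq_bigr do rewrite -mulr_sumr.
rewrite -mulr_suml -expr2.
have m0 : 0 < m by rewrite ltr0n -ltnS prednK.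
(* The choice d = 7 yields the exponent 7/8 and the constant 8. *)
have hs := sum_expRN_volume_le 7 D m0 N0.
(* The total N^(2ED) splits into N^(2D(E-1)) for the other vectors and N^(2D) for the two at [i]. *)
have -> : q ^+ 2 * #|{: exponents}|%:R = (N ^ D)%:R ^+ (2 * E.-1) * (m `^ (- (1 - 8^-1)) * (8 * N)%:R ^+ D) ^+ 2.
  rewrite card_exponents /q natrM exprMn !natrX -/m.
  have -> : (2 * E * D = D * (2 * E.-1) + D * 2)%N.
    by rewrite -{1}(prednK E0); ring.
  by rewrite exprD (exprM _ D) (exprM _ D 2) !exprMn; ring.
rewrite ler_wpM2l ?exprn_ge0 ?ler0n // lerXn2r ?nnegrE ?mulr_ge0 ?powR_ge0 ?exprn_ge0 ?ler0n //.
by apply: sumr_ge0 => x _; apply: expR_ge0.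
Qed.

End BadSets.

(** * Union bound over all bad exponents *)

Theorem theorem3p9 (R : realType) :
  exists E0 : nat, forall E D N : nat,
    (0 < E)%N -> (0 < D)%N -> (0 < N)%N ->
    (E0 <= E)%N -> expR (9 * D%:R) <= E%:R :> R -> (E ^ 4 <= N)%N ->
    forall (p : 'I_D -> nat) (p_prime : forall j, prime (p j)),
      injective p ->
      1 - (E%:R `^ (4^-1))^-1 <=
        outcome_prob R
          (fun w : outcome 1 E D N => flexible (random_graph p_prime w)).
Proof.
have [E0 hE0] := failure_bound_small R.
exists E0 => E D N E_gt0 D_gt0 N_gt0 E0E DE EN p p_prime p_inj.
have [E_gt1 bound] := hE0 E D E0E E_gt0 DE.
pose B := collisions E D N :|: \bigcup_(i : 'I_E) undominated D N i.
have good (w : outcome 1 E D N) : w.2 \notin B -> flexible (random_graph p_prime w).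
  rewrite finset.in_setU negb_or => /andP[/bigcupP nocoll /bigcupP undom].
  apply: flexible_random_graph => //.
    move=> e e' j ee'; apply/negP => eqw; apply: nocoll.
    by exists (e, e', j); rewrite ?inE.
  move=> i; have : w.2 \notin undominated D N i.
    by apply/negP => h; apply: undom; exists i.
  rewrite inE negb_forall => /existsP[e]; rewrite negb_imply negbK => /andP[ei].
  have below b : exponent_vector w.2 e \in box (exponent_vector w.2 (i, b)) ->
      [forall j, w.2 (e, j) <= w.2 ((i, b), j)]%N.
    by rewrite inE => /forallP h; apply/forallP => j; have := h j; rewrite !ffunE.
  by rewrite finset.in_setU => /orP[] /below h; exists e => //; [exists false|exists true].
apply: le_trans (outcome_prob_ge R _ N_gt0 good) => //.
rewrite lerD2l lerN2; apply: le_trans bound.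
set T := (X in #|B|%:R / X).
apply: (@le_trans _ _ (#|collisions E D N|%:R / T +
    \sum_(i : 'I_E) #|undominated D N i|%:R / T)).
  rewrite -mulr_suml -mulrDl ler_wpM2r ?invr_ge0 ?ler0n // -natr_sum -natrD ler_nat.
  by apply: leq_trans (leq_card_setU _ _) _; rewrite leq_add2l card_bigcup_le.
apply: lerD.
  apply: le_trans (card_collisions_le E D R N_gt0) _.
  (* Here N >= E^4 replaces 1/N by 1/E^4. *)
  rewrite ler_wpM2l ?mulr_ge0 ?exprn_ge0 ?ler0n // -natrX.
  by rewrite lef_pV2 ?posrE ?ltr0n ?expn_gt0 ?E_gt0 // ler_nat.
apply: le_trans (ler_sum _ (fun i _ => card_undominated_le D R i E_gt1 N_gt0)) _.
by rewrite sumr_const card_ord mulr_natl.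
Qed.
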